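(* The following discrete inf-sup condition with constant one holds: $$\sup_{\substack{(v_{hp},q_{hp})\in V_{hp}\times Q_{hp}\\ \|(v_{hp},q_{hp})\|\ne0}}\frac{(\mu_{hp},q_{hp})_{0,\Omega}}{\|(v_{hp},q_{hp})\|}=\|\mu_{hp}\|_{0,\Omega}\qquad\forall\mu_{hp}\in Q_{hp}.$$
   Context: Let $d\in\{2,3\}$, $\Omega\subset\mathbb{R}^d$ a bounded domain with Lipschitz boundary $\Gamma=\partial\Omega$ and $\Gamma_D\subseteq\Gamma$. $\mathbb{S}_{d,0}$ is the space of symmetric real $d\times d$ matrices with vanishing trace. $(\cdot,\cdot)_{0,\Omega}$, $\|\cdot\|_{0,\Omega}$ are the $L^2(\Omega)$ inner product and norm for vector- or matrix-valued functions (the Frobenius inner product being used for matrices). $V:=\{v\in H^1(\Omega,\mathbb{R}^d): v=0\text{ on }\Gamma_D\}$ (traces), $Q:=L^2(\Omega,\mathbb{S}_{d,0})$, $\varepsilon(v):=\frac12(\nabla v+(\nabla v)^\top)$, $\|(v,q)\|^2:=\|v\|_{0,\Omega}^2+\|\varepsilon(v)\|_{0,\Omega}^2+\|q\|_{0,\Omega}^2$. $\mathcal{T}_h$ is a locally quasi-uniform finite element mesh of $\Omega$ of convex, shape regular quadrilaterals ($d=2$) or hexahedrons ($d=3$); $\widehat T=[-1,1]^d$; $F_T:\widehat T\to T$ is the bi-/tri-linear bijective element mapping; $p_T\in\mathbb{N}$, $p_T\ge1$, is the polynomial degree of $T$ (degrees of neighboring elements being comparable). $\mathbb{P}_r(\widehat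 T)$ is the space of polynomials on $\widehat T$ of degree at most $r$ in each variable. $$V_{hp}:=\{v\in V: v|_T\circ F_T\in(\mathbb{P}_{p_T}(\widehat T))^d\ \forall T\in\mathcal{T}_h\},\quad Q_{hp}:=\{q\in Q: q|_T\circ F_T\in(\mathbb{P}_{p_T-1}(\widehat T))^{d\times d}\ \forall T\in\mathcal{T}_h\}.$$ *)

(* Defs.v *)
From HB Require Import structures.
From mathcomp Require Import all_boot all_order all_algebra.
From mathcomp Require Import all_classical all_reals all_analysis.

Set Implicit Arguments.
Unset Strict Implicit.
Unset Printing Implicit Defensive.

Import Order.TTheory GRing.Theory Num.Theory.
Import numFieldNormedType.Exports.

Local Open Scope classical_set_scope.
Local Open Scope ring_scope.

Definition rV_display : measure_display. Proof. exact: default_measure_display. Qed.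

Section measurable_rV.
Context {R : realType} (n : nat).

Let coord (i : 'I_n) (x : 'rV[R]_n) : R := x ord0 i.

Let rV_set0 : g_sigma_preimage coord set0.
Proof. exact: sigma_algebra0. Qed.

Let rV_setC A : g_sigma_preimage coord A -> g_sigma_preimage coord (~` A).
Proof. exact: sigma_algebraC. Qed.

Let rV_bigcup (F : _^nat) : (forall i, g_sigma_preimage coord (F i)) ->
  g_sigma_preimage coord (\bigcup_i (F i)).
Proof. exact: sigma_algebra_bigcup. Qed.

(* The product sigma-algebra; R being second countable, it is the Borel
   sigma-algebra of R^n. *)
HB.instance Definition _ := @isMeasurable.Build rV_display
  'rV[R]_n (g_sigma_preimage coord) rV_set0 rV_setC rV_bigcup.

Lemma measurable_coord (i : 'I_n) :
  measurable_fun [set: 'rV[R]_n] (fun x : 'rV[R]_n => x ord0 i).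
Proof.
move=> _ Y mY; rewrite setTI; apply: sub_sigma_algebra => /=.
rewrite -bigcup_seq/=; exists i => /=; first by rewrite mem_index_enum.
by exists Y => //; rewrite setTI.
Qed.

Lemma measurable_fun_coord d (T : measurableType d) (f : T -> 'rV[R]_n) :
  (forall i, measurable_fun [set: T] (fun t => f t ord0 i)) ->
  measurable_fun [set: T] f.
Proof.
move=> mf _ A mA; rewrite setTI.
suff : preimage_set_system [set: T] f (g_sigma_preimage coord) `<=` measurable.
  by apply; exists A => //; rewrite setTI.
rewrite -g_sigma_preimage_comp.
apply: smallest_sub; first exact: sigma_algebra_measurable.
rewrite -bigcup_seq; apply: bigcup_sub => i _ B [C mC <-].
exact: mf.
Qed.

End measurable_rV.

(* Lebesgue measure on R^n as the n-fold product of the one on R, transported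
   along (a, v) |-> (a, v_0, ..., v_(n-1)). *)
Section lebesgue_rV.
Context {R : realType}.
Local Open Scope ereal_scope.

Definition rV_cons n (p : R * 'rV[R]_n) : 'rV[R]_n.+1 :=
  row_mx (p.1)%:M p.2.

Definition rV_uncons n (x : 'rV[R]_n.+1) : R * 'rV[R]_n :=
  (x ord0 ord0, \row_j x ord0 (lift ord0 j)).

Lemma rV_cons0 n p : @rV_cons n p ord0 ord0 = p.1.
Proof. by rewrite mxE; case: splitP => // j _; rewrite (ord1 j) mxE. Qed.

Lemma rV_consS n p j : @rV_cons n p ord0 (lift ord0 j) = p.2 ord0 j.
Proof.
rewrite mxE; case: splitP => [k|k] /=; first by rewrite (ord1 k).
by rewrite /bump leq0n !add1n => -[/val_inj ->].
Qed.

Lemma rV_consK n : cancel (@rV_cons n) (@rV_uncons n).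
Proof.
move=> [a v]; congr pair; first by rewrite rV_cons0.
by apply/rowP => j; rewrite mxE rV_consS.
Qed.

Lemma measurable_rV_cons n : measurable_fun setT (@rV_cons n).
Proof.
apply: measurable_fun_coord => i; case: (unliftP ord0 i) => [j|] ->.
  under eq_fun do rewrite rV_consS.
  by apply: (measurableT_comp (measurable_coord j)).
rewrite (_ : (fun _ => _) = fst) //.
by apply/funext => p; rewrite rV_cons0.
Qed.

Lemma measurable_rV_uncons n : measurable_fun setT (@rV_uncons n).
Proof.
apply/measurable_fun_pairP; split; first exact: measurable_coord.
apply: measurable_fun_coord => i.
rewrite (_ : (fun _ => _) = (fun x : 'rV[R]_n.+1 => x ord0 (lift ord0 i))).
  exact: measurable_coord.
by apply/funext => p; rewrite /= mxE.
Qed.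

Lemma sigma_finite_product d1 d2 (T1 : measurableType d1)
  (T2 : measurableType d2) (m1 : {sigma_finite_measure set T1 -> \bar R})
  (m2 : {sigma_finite_measure set T2 -> \bar R}) : sigma_finite setT (m1 \x m2).
Proof.
have /sigma_finiteP[F [TF ndF Foo]] := sigma_finiteT m1.
have /sigma_finiteP[G [TG ndG Goo]] := sigma_finiteT m2.
exists (fun n => F n `*` G n).
 rewrite -setXTT TF TG predeqE => -[x y]; split.
    move=> [/= [n _ Fnx] [k _ Gky]]; exists (maxn n k) => //; split.
    - by move: x Fnx; exact/subsetPset/ndF/leq_maxl.
    - by move: y Gky; exact/subsetPset/ndG/leq_maxr.
  by move=> [n _ []/= ? ?]; split; exists n.
move=> k; have [? ?] := Foo k; have [? ?] := Goo k.
split; first exact: measurableX.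
by rewrite product_measure1E// lte_mul_pinfty// ge0_fin_numE.
Qed.

Section step.
Variables (n : nat) (mu : {sigma_finite_measure set 'rV[R]_n -> \bar R}).

Definition lebesgue_rVS : set 'rV[R]_n.+1 -> \bar R :=
  pushforward (lebesgue_measure \x mu) (@rV_cons n).

Let lebesgue_rVS0 : lebesgue_rVS set0 = 0.
Proof. by rewrite /lebesgue_rVS /pushforward preimage_set0 measure0. Qed.

Let mpre A : measurable A -> measurable (@rV_cons n @^-1` A).
Proof. by move=> mA; rewrite -[X in measurable X]setTI; exact: measurable_rV_cons. Qed.

Let lebesgue_rVS_ge0 A : 0 <= lebesgue_rVS A.
Proof. rewrite /lebesgue_rVS /pushforward; exact: measure_ge0. Qed.

Let lebesgue_rVS_sigma_additive : semi_sigma_additive lebesgue_rVS.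
Proof.
move=> F mF tF mUF; rewrite /lebesgue_rVS /pushforward preimage_bigcup.
apply: measure_semi_sigma_additive.
- by move=> k; exact: mpre.
- apply/trivIsetP => /= i j _ _ ij; rewrite -preimage_setI.
  by move/trivIsetP : tF => /(_ _ _ _ _ ij) ->//; rewrite preimage_set0.
- by rewrite -preimage_bigcup; exact: mpre.
Qed.

HB.instance Definition _ := isMeasure.Build _ _ _ lebesgue_rVS
  lebesgue_rVS0 lebesgue_rVS_ge0 lebesgue_rVS_sigma_additive.

Let lebesgue_rVS_sigma_finite : sigma_finite setT lebesgue_rVS.
Proof.
have [F FT Foo] : sigma_finite setT (lebesgue_measure \x mu).
  exact: sigma_finite_product.
exists (fun k => @rV_uncons n @^-1` F k).
  by rewrite -preimage_bigcup -FT preimage_setT.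
move=> k; have [mF Fk] := Foo k; split.
  by rewrite -[X in measurable X]setTI; exact: measurable_rV_uncons.
rewrite /lebesgue_rVS /pushforward -comp_preimage.
by rewrite (_ : _ \o _ = id) //; apply/funext => p; exact: rV_consK.
Qed.

HB.instance Definition _ := Measure_isSigmaFinite.Build _ _ _ lebesgue_rVS
  lebesgue_rVS_sigma_finite.
End step.

Fixpoint lebesgue_rV n : {sigma_finite_measure set 'rV[R]_n -> \bar R} :=
  if n is n'.+1 then lebesgue_rVS (lebesgue_rV n') else \d_(0%R : 'rV[R]_0).

End lebesgue_rV.

Section euclidean.
Context {R : realType}.

(* The Frobenius inner product; on row vectors it is the Euclidean one. The
   library norm of a matrix is the maximum norm. *)
Definition frob m n (A B : 'M[R]_(m, n)) : R := \sum_i \sum_j A i j * B i j.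

Definition enorm m n (A : 'M[R]_(m, n)) : R := Num.sqrt (frob A A).

Definition ediam n (A : set 'rV[R]_n) : R :=
  sup [set enorm (x - y) | x in A & y in A].

End euclidean.

Section hausdorff.
Context {R : realType} (n s : nat).
Local Open Scope ereal_scope.

(* omega_s * (diam C / 2)^s if diam C <= delta and +oo otherwise, where omega_s
   is the volume of the unit ball of R^s. The supremum is over pairs of points,
   with 0 added so that the empty set has weight 0 also for s = 0. *)
Definition hausdorff_weight (delta : R) (C : set 'rV[R]_n) : \bar R :=
  ereal_sup (0 |` [set if (enorm (x - y) <= delta)%R
    then lebesgue_rV s [set z | (enorm z <= 1)%R] *
         ((enorm (x - y) / 2) ^+ s)%:E
    else +oo | x in C & y in C]).

(* Coverings are by Borel sets here, which gives the usual value since a set and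
   its closure have the same diameter. *)
Definition hausdorff (A : set 'rV[R]_n) : \bar R :=
  ereal_sup [set (hausdorff_weight delta)^*%mu A | delta in [set delta | 0 < delta]%R].

Let weight0 delta : hausdorff_weight delta set0 = 0.
Proof.
rewrite /hausdorff_weight (_ : [set _ | _ in _ & _ in _] = set0).
  by rewrite setU0 ereal_sup1.
by rewrite -subset0 => _ [x []].
Qed.

Let weight_ge0 delta C : 0 <= hausdorff_weight delta C.
Proof. by apply: ereal_sup_ubound; left. Qed.

Let hausdorff0 : hausdorff set0 = 0.
Proof.
apply/eqP; rewrite eq_le; apply/andP; split.
  by apply: ge_ereal_sup => _ [delta _ <-]; rewrite mu_ext0.
apply: ereal_sup_ubound; exists 1%R => //=; exact: mu_ext0.
Qed.

Let ext_ge0 delta A : 0 <= (hausdorff_weight delta)^*%mu A.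
Proof. exact: (mu_ext_ge0 (weight_ge0 delta)). Qed.

Let hausdorff_ge0 A : 0 <= hausdorff A.
Proof.
apply: (@le_trans _ _ ((hausdorff_weight 1%R)^*%mu A)); first exact: ext_ge0.
by apply: ereal_sup_ubound; exists 1%R => /=.
Qed.

Let le_hausdorff : {homo hausdorff : A B / A `<=` B >-> A <= B}.
Proof.
move=> A B AB; apply: ge_ereal_sup => _ [delta d0 <-].
apply: (le_trans (le_mu_ext _ AB)).
by apply: ereal_sup_ubound; exists delta.
Qed.

Let hausdorff_sigma_subadditive : sigma_subadditive hausdorff.
Proof.
move=> F; apply: ge_ereal_sup => _ [delta d0 <-].
apply: (le_trans (mu_ext_sigma_subadditive (weight_ge0 delta) _)).
apply: lee_nneseries => [k _ _|k _]; first exact: ext_ge0.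
by apply: ereal_sup_ubound; exists delta.
Qed.

HB.instance Definition _ := isOuterMeasure.Build R 'rV[R]_n hausdorff
  hausdorff0 hausdorff_ge0 le_hausdorff hausdorff_sigma_subadditive.

End hausdorff.

(* The measure on the Caratheodory sigma-algebra, which contains the Borel one. *)
Definition hausdorff_measure (R : realType) (n s : nat) :
    {measure set (caratheodory_type
      (hausdorff s : {outer_measure set 'rV[R]_n -> \bar R})) -> \bar R} :=
  (hausdorff s : {outer_measure set 'rV[R]_n -> \bar R}).

Section L2.
Context {R : realType} d (T : measurableType d).
Variables (mu : {measure set T -> \bar R}) (D : set T) (m n : nat).
Implicit Types f g : T -> 'M[R]_(m, n).

Definition L2fun f : Prop :=
  (forall i j, measurable_fun D (fun x => f x i j)) /\
  (\int[mu]_(x in D) (frob (f x) (f x))%:E < +oo)%E.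

Definition L2inner f g : R := \int[mu]_(x in D) frob (f x) (g x).

Definition L2norm f : R := Num.sqrt (L2inner f f).

Definition L2cvg (f_ : nat -> T -> 'M[R]_(m, n)) f : Prop :=
  (fun k => \int[mu]_(x in D) (frob (f_ k x - f x) (f_ k x - f x))%:E)%E
    @ \oo --> (0 : \bar R)%E.

End L2.

Section domain.
Context {R : realType} {d : nat}.
Implicit Types (Omega GammaD : set 'rV[R]_d).

Definition boundary Omega := closure Omega `\` interior Omega.

(* Near each boundary point there is a unit vector e (the local vertical axis)
   such that Omega is the strict epigraph of a Lipschitz function of the
   horizontal component y - <y,e>e. *)
Definition lipschitz_boundary Omega : Prop :=
  forall x, boundary Omega x ->
  exists (e : 'rV[R]_d) (phi : 'rV[R]_d -> R) (k : R),
    [/\ enorm e = 1, k.-lipschitz phi &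
        \forall y \near x,
          Omega y <-> phi (y - frob y e *: e) < frob y e].

Definition lipschitz_domain Omega : Prop :=
  [/\ Omega !=set0, open Omega, connected Omega, bounded_set Omega &
      lipschitz_boundary Omega].

Definition partial (j : 'I_d) (f : 'rV[R]_d -> R) : 'rV[R]_d -> R :=
  fun x => 'D_('e_j) f x.

(* C^oo on R^d: all iterated partial derivatives exist and are continuous. *)
Definition smooth (f : 'rV[R]_d -> R) : Prop :=
  forall s : seq 'I_d, let g := foldr partial f s in
  continuous g /\ forall x j, derivable g x 'e_j.

Definition test_function Omega (phi : 'rV[R]_d -> R) : Prop :=
  smooth phi /\
  exists K, [/\ compact K, K `<=` Omega & forall x, ~ K x -> phi x = 0].

(* G x i j is the weak derivative of the i-th component in direction j. *)
Definition weak_gradient Omega (v : 'rV[R]_d -> 'rV[R]_d)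
    (G : 'rV[R]_d -> 'M[R]_d) : Prop :=
  forall i j phi, test_function Omega phi ->
  \int[lebesgue_rV d]_(x in Omega) (v x ord0 i * partial j phi x) =
  - \int[lebesgue_rV d]_(x in Omega) (G x i j * phi x).

(* H^1(Omega, R^d): a function together with its weak gradient, which is unique
   up to a null set. Functions are not quotiented by almost everywhere
   equality. *)
Record H1 Omega := MkH1 {
  H1fun :> 'rV[R]_d -> 'rV[R]_d;
  grad : 'rV[R]_d -> 'M[R]_d;
  _ : L2fun (lebesgue_rV d) Omega H1fun;
  _ : L2fun (lebesgue_rV d) Omega grad;
  _ : weak_gradient Omega H1fun grad }.

Definition eps Omega (v : H1 Omega) : 'rV[R]_d -> 'M[R]_d :=
  fun x => 2^-1 *: (grad v x + (grad v x)^T).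

(* g in L^2(boundary) is the trace of v: the graph of the continuous extension
   to H^1 of the restriction of smooth functions to the boundary. *)
Definition is_trace Omega (v : H1 Omega) (g : 'rV[R]_d -> 'rV[R]_d) : Prop :=
  L2fun (hausdorff_measure R d d.-1) (boundary Omega) g /\
  exists phi : nat -> 'rV[R]_d -> 'rV[R]_d,
  [/\ forall k i, smooth (fun x => phi k x ord0 i),
      L2cvg (lebesgue_rV d) Omega phi v,
      L2cvg (lebesgue_rV d) Omega
        (fun k x => \matrix_(i, j) partial j (fun y => phi k y ord0 i) x)
        (grad v) &
      L2cvg (hausdorff_measure R d d.-1) (boundary Omega) phi g].

Definition V Omega GammaD : set (H1 Omega) :=
  [set v | exists2 g, is_trace v g &
    \forall x \ae hausdorff_measure R d d.-1, GammaD x -> g x = 0].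

(* symmetric trace-free matrices *)
Definition Sd0 : set 'M[R]_d := [set A | A^T = A /\ \tr A = 0].

Definition Q Omega : set ('rV[R]_d -> 'M[R]_d) :=
  [set q | L2fun (lebesgue_rV d) Omega q /\ forall x, Omega x -> Sd0 (q x)].

Definition VQnorm Omega (v : H1 Omega) (q : 'rV[R]_d -> 'M[R]_d) : R :=
  Num.sqrt (L2norm (lebesgue_rV d) Omega v ^+ 2 +
            L2norm (lebesgue_rV d) Omega (eps v) ^+ 2 +
            L2norm (lebesgue_rV d) Omega q ^+ 2).

End domain.

Section mesh.
Context {R : realType} {d : nat}.

Definition refcube : set 'rV[R]_d := [set x | forall i, -1 <= x ord0 i <= 1].

(* polynomials of degree at most r in each variable *)
Definition Qpoly (r : nat) (f : 'rV[R]_d -> R) : Prop :=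
  exists c : {ffun 'I_d -> 'I_r.+1} -> R,
  forall x, f x = \sum_a c a * \prod_i x ord0 i ^+ a i.

Definition Qpoly_mx (r m n : nat) (f : 'rV[R]_d -> 'M[R]_(m, n)) : Prop :=
  forall i j, Qpoly r (fun x => f x i j).

(* A mesh is given by its element maps F_T, extended from the reference cube to
   R^d by their polynomial expressions, and the polynomial degrees p_T. *)
Record mesh := Mesh {
  nelt : nat;
  emap : 'I_nelt -> 'rV[R]_d -> 'rV[R]_d;
  edeg : 'I_nelt -> nat }.

Definition elt (Th : mesh) (T : 'I_(nelt Th)) : set 'rV[R]_d :=
  emap T @` refcube.

Definition neighbors (Th : mesh) (T T' : 'I_(nelt Th)) : Prop :=
  elt T `&` elt T' !=set0.

(* |DF_T(x)| <= gamma h_T and |DF_T(x)^-1| <= gamma / h_T, with h_T the diameter. *)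
Definition shape_regular (gamma : R) (Th : mesh) : Prop :=
  forall (T : 'I_(nelt Th)) x v, refcube x ->
  gamma^-1 * ediam (elt T) * enorm v <= enorm ('D_v (emap T) x)
    <= gamma * ediam (elt T) * enorm v.

Definition locally_quasi_uniform (gamma : R) (Th : mesh) : Prop :=
  forall T T' : 'I_(nelt Th), neighbors T T' ->
  ediam (elt T) <= gamma * ediam (elt T').

Definition comparable_degrees (gamma : R) (Th : mesh) : Prop :=
  forall T T' : 'I_(nelt Th), neighbors T T' ->
  (edeg T)%:R <= gamma * (edeg T')%:R.

(* Hanging nodes are allowed: elements are only required not to overlap. *)
Record fe_mesh (gamma : R) (Omega : set 'rV[R]_d) (Th : mesh) : Prop := {
  fe_multilinear : forall T : 'I_(nelt Th), Qpoly_mx 1 (emap T);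
  fe_injective : forall T : 'I_(nelt Th), set_inj refcube (emap T);
  fe_convex : forall T : 'I_(nelt Th), convex_set (elt T);
  fe_cover : closure Omega = \bigcup_(T : 'I_(nelt Th)) elt T;
  fe_disjoint : forall T T' : 'I_(nelt Th), T != T' ->
    interior (elt T) `&` interior (elt T') = set0;
  fe_shape_regular : shape_regular gamma Th;
  fe_quasi_uniform : locally_quasi_uniform gamma Th;
  fe_degree : forall T : 'I_(nelt Th), (1 <= edeg T)%N;
  fe_comparable : comparable_degrees gamma Th }.

Definition piecewise_poly (Th : mesh) (r : 'I_(nelt Th) -> nat) m n
    (f : 'rV[R]_d -> 'M[R]_(m, n)) : Prop :=
  forall T, exists2 P : 'rV[R]_d -> 'M[R]_(m, n), Qpoly_mx (r T) P &
    \forall x \ae lebesgue_rV d, refcube x -> f (emap T x) = P x.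

Definition Vhp (Omega GammaD : set 'rV[R]_d) (Th : mesh) : set (H1 Omega) :=
  [set v | V GammaD v /\ piecewise_poly (@edeg Th) v].

Definition Qhp (Omega : set 'rV[R]_d) (Th : mesh) :
    set ('rV[R]_d -> 'M[R]_d) :=
  [set q | Q Omega q /\ piecewise_poly (fun T : 'I_(nelt Th) => (edeg T).-1) q].

End mesh.
Arguments mesh : clear implicits.

(* Main.v *)
Require Import Defs.
From HB Require Import structures.
From mathcomp Require Import all_boot all_order all_algebra.
From mathcomp Require Import all_classical all_reals all_analysis.
From mathcomp Require Import measurable_realfun ring lra.

Import Order.TTheory GRing.Theory Num.Theory.
Import numFieldNormedType.Exports.

Local Open Scope classical_set_scope.
Local Open Scope ring_scope.

(** The functional involves only q, so the first component of a test pair can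
    only enlarge the denominator. The product norm dominates the L^2 norm of q
    (L2norm_le_VQnorm), hence the Cauchy-Schwarz inequality (L2inner_abs_le)
    bounds every quotient by the norm of mu. For pairs (0, q) the two norms agree
    (VQnorm_0), and mu itself lies in the discrete space, so the pair (0, mu)
    attains this bound, provided that mu has nonzero norm.

    If mu has norm zero, every quotient is zero, and what remains is to exhibit
    one admissible pair of nonzero norm, as otherwise the supremum would be that
    of the empty set. The pair (0, A) with A a constant nonzero symmetric
    trace-free matrix serves (exists_Qhp_norm_gt0): such a matrix exists in every
    dimension at least two, and constants belong to all the polynomial spaces.
    Its norm is positive and finite because a nonempty bounded open set has
    positive finite Lebesgue measure.

    The analysis needed is thus that open sets are measurable for the product
    sigma-algebra and have positive measure; both come from cubes, whose measure
    is computed by induction on the dimension (lebesgue_cube). *)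

Set Implicit Arguments.
Unset Strict Implicit.
Unset Printing Implicit Defensive.

(** * Frobenius inner product *)

Section frobenius.
Context {R : realType} (m n : nat).
Implicit Types A B : 'M[R]_(m, n).

Lemma frob_ge0 A : 0 <= frob A A.
Proof. by do 2 apply: sumr_ge0 => ? _; rewrite -expr2 sqr_ge0. Qed.

Lemma frob_gt0 A : A != 0 -> 0 < frob A A.
Proof.
move=> A0; rewrite lt_neqAle frob_ge0 andbT; apply: contraNneq A0 => /esym FA.
apply/eqP/matrixP => i j; rewrite mxE; apply/eqP; rewrite -sqrf_eq0 expr2.
have rowsq_ge0 k : true -> 0 <= \sum_l A k l * A k l.
  by move=> _; apply: sumr_ge0 => ? _; rewrite -expr2 sqr_ge0.
have sq_ge0 l : true -> 0 <= A i l * A i l by move=> _; rewrite -expr2 sqr_ge0.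
by rewrite (psumr_eq0P sq_ge0 (psumr_eq0P rowsq_ge0 FA isT) isT).
Qed.

Lemma frob0l B : frob 0 B = 0.
Proof.
by rewrite /frob big1 // => i _; rewrite big1 // => j _; rewrite mxE mul0r.
Qed.

(** This is the nonnegativity of the squared Frobenius norm of A - t B. It
    bounds the product by integrable squares, and its integrated form gives the
    Cauchy-Schwarz inequality. *)
Lemma young_frob t A B : 2 * t * frob A B <= frob A A + t ^+ 2 * frob B B.
Proof.
rewrite /frob !mulr_sumr -big_split; apply: ler_sum => i _ /=.
rewrite !mulr_sumr -big_split; apply: ler_sum => j _ /=.
by have := sqr_ge0 (A i j - t * B i j); nra.
Qed.

End frobenius.

(** The quadratic polynomial a - 2 c t + b t^2 is nonnegative, so its
    discriminant is nonpositive. *)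
Lemma sqr_le_mul_of_young (R : realType) (a b c : R) : 0 <= a -> 0 <= b ->
  (forall t, 2 * t * c <= a + t ^+ 2 * b) -> c ^+ 2 <= a * b.
Proof.
move=> a0 b0 H; have [b1|b1] := ltP 0 b.
  (* the minimizer of the polynomial *)
  have := H (c / b); have -> : 2 * (c / b) * c = 2 * (c ^+ 2 / b).
    by field; rewrite gt_eqF.
  have -> : (c / b) ^+ 2 * b = c ^+ 2 / b by field; rewrite gt_eqF.
  by rewrite mulr_natl mulr2n lerD2r ler_pdivrMr.
have {b1} b0 : b = 0 by apply/eqP; rewrite eq_le b1 b0.
have [->|c0] := eqVneq c 0; first by rewrite b0 mulr0 expr0n.
(* a nonconstant affine function takes a negative value *)
have := H ((a + 1) / (2 * c)).
have -> : 2 * ((a + 1) / (2 * c)) * c = a + 1 by field.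
by rewrite b0 mulr0; lra.
Qed.

(** * Square integrable matrix fields *)

Section cauchy_schwarz.
Context {R : realType} d (T : measurableType d).
Variables (mu : {measure set T -> \bar R}) (D : set T) (m n : nat).
Hypothesis mD : measurable D.
Implicit Types f g : T -> 'M[R]_(m, n).

Lemma measurable_frob f g :
  (forall i j, measurable_fun D (fun x => f x i j)) ->
  (forall i j, measurable_fun D (fun x => g x i j)) ->
  measurable_fun D (fun x => frob (f x) (g x)).
Proof.
move=> mf mg; rewrite /frob; apply: measurable_sum => i.
by apply: measurable_sum => j; exact: measurable_funM.
Qed.

Lemma integrable_frob_sqr f : L2fun mu D f ->
  mu.-integrable D (EFin \o (fun x => frob (f x) (f x))).
Proof.
move=> [mf If]; apply/integrableP; split.
  by apply/measurable_EFinP; exact: measurable_frob.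
rewrite (eq_integral (fun x => (frob (f x) (f x))%:E)) // => x _ /=.
by rewrite ger0_norm // frob_ge0.
Qed.

Lemma integrable_frob f g : L2fun mu D f -> L2fun mu D g ->
  mu.-integrable D (EFin \o (fun x => frob (f x) (g x))).
Proof.
move=> Lf Lg; apply: (@le_integrable _ _ _ _ _ mD _
    ((EFin \o (fun x => frob (f x) (f x))) \+
     (EFin \o (fun x => frob (g x) (g x)))))%E.
- by apply/measurable_EFinP; apply: measurable_frob; [case: Lf|case: Lg].
- move=> x _ /=; rewrite lee_fin [leRHS]ger0_norm ?addr_ge0 ?frob_ge0 //.
  rewrite ler_norml.
  have := young_frob 1 (f x) (g x); have := young_frob (-1) (f x) (g x).
  have := frob_ge0 (f x); have := frob_ge0 (g x); lra.
- by apply: integrableD => //; exact: integrable_frob_sqr.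
Qed.

Lemma L2inner_ge0 f : 0 <= L2inner mu D f f.
Proof. by apply: Rintegral_ge0 => x _; exact: frob_ge0. Qed.

Lemma young_L2inner t f g : L2fun mu D f -> L2fun mu D g ->
  2 * t * L2inner mu D f g <= L2inner mu D f f + t ^+ 2 * L2inner mu D g g.
Proof.
move=> Lf Lg; have Ifg := integrable_frob Lf Lg.
have If := integrable_frob_sqr Lf; have Ig := integrable_frob_sqr Lg.
have IZ k h : mu.-integrable D (EFin \o h) ->
    mu.-integrable D (EFin \o (fun x => k * h x)).
  by move=> Ih; exact: (integrableZl mD k Ih).
rewrite /L2inner -!RintegralZl // -RintegralD //; last exact: IZ.
apply: le_Rintegral => //.
- exact: IZ.
- exact: (integrableD mD If (IZ (t ^+ 2) _ Ig)).
- by move=> x _; exact: young_frob.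
Qed.

Lemma L2inner_abs_le f g : L2fun mu D f -> L2fun mu D g ->
  `|L2inner mu D f g| <= L2norm mu D f * L2norm mu D g.
Proof.
move=> Lf Lg; rewrite /L2norm -sqrtrM ?L2inner_ge0 // -sqrtr_sqr ler_sqrt.
  by apply: sqr_le_mul_of_young => [||t]; rewrite ?L2inner_ge0 ?young_L2inner.
by rewrite mulr_ge0 ?L2inner_ge0.
Qed.

Lemma L2fun_cst (A : 'M[R]_(m, n)) : (mu D < +oo)%E -> L2fun mu D (cst A).
Proof.
move=> muD; split; first by move=> i j; exact: measurable_cst.
rewrite [ltLHS](integral_cst mu mD (frob A A)%:E).
by rewrite lte_mul_pinfty // lee_fin frob_ge0.
Qed.

Lemma L2norm_cst_gt0 (A : 'M[R]_(m, n)) : A != 0 ->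
  (0 < mu D < +oo)%E -> 0 < L2norm mu D (cst A).
Proof.
move=> A0 muD; rewrite sqrtr_gt0 [ltRHS](Rintegral_cst mu mD (frob A A)).
by rewrite mulr_gt0 ?frob_gt0 ?fine_gt0.
Qed.

End cauchy_schwarz.

Lemma L2fun0 (R : realType) d (T : measurableType d)
    (mu : {measure set T -> \bar R}) (D : set T) m n :
  L2fun mu D (fun=> 0 : 'M[R]_(m, n)).
Proof.
split; first by move=> i j; exact: measurable_cst.
by rewrite integral0_eq // => x _; rewrite frob0l.
Qed.

Lemma L2norm0 (R : realType) d (T : measurableType d)
    (mu : {measure set T -> \bar R}) (D : set T) m n (f : T -> 'M[R]_(m, n)) :
  (forall x, f x = 0) -> L2norm mu D f = 0.
Proof.
move=> f0; rewrite /L2norm /L2inner /Rintegral integral0_eq ?sqrtr0 // => x _.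
by rewrite f0 frob0l.
Qed.

(** * Lebesgue measure of open sets *)

Section cubes.
Context {R : realType}.

(** The open balls of the maximum norm, except that for n = 0 the cube is the
    whole space even when r is not positive. *)
Definition cube n (x : 'rV[R]_n) (r : R) : set 'rV[R]_n :=
  [set y | forall i, ball (x ord0 i) r (y ord0 i)].

Lemma measurable_cube n (x : 'rV[R]_n) r : measurable (cube x r).
Proof.
rewrite (_ : cube x r = \bigcap_(i in [set: 'I_n])
    ((fun y : 'rV[R]_n => y ord0 i) @^-1` ball (x ord0 i) r)).
  apply: fin_bigcap_measurable => // i _; rewrite -[X in measurable X]setTI.
  by apply: measurable_coord => //; exact: measurable_ball.
by apply/seteqP; split=> y /= Hy i; [move=> _; exact: Hy|exact: Hy].
Qed.

(** The measure in dimension n + 1 is a product along the splitting of a vector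
    into its first coordinate and the others, which splits a cube likewise. *)
Lemma lebesgue_cube n (x : 'rV[R]_n) r : 0 <= r ->
  lebesgue_rV n (cube x r) = ((r *+ 2) ^+ n)%:E.
Proof.
move=> r0; elim: n x => [|n IH] x.
  by rewrite /= diracE mem_set // => -[].
rewrite /= /lebesgue_rVS /pushforward.
have -> : @rV_cons R n @^-1` cube x r =
    ball (x ord0 ord0) r `*` cube (\row_j x ord0 (lift ord0 j)) r.
  apply/seteqP; split=> -[a v] /=.
    move=> H; split=> /=; first by have := H ord0; rewrite rV_cons0.
    by move=> i; have := H (lift ord0 i); rewrite rV_consS mxE.
  move=> [/= Ha Hv] i; case: (unliftP ord0 i) => [j|] ->.
    by rewrite rV_consS; have := Hv j; rewrite mxE.
  by rewrite rV_cons0.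
rewrite product_measure1E; [|exact: measurable_ball|exact: measurable_cube].
rewrite IH [X in (X * _)%E](lebesgue_measure_ball (x ord0 ord0) r0).
by rewrite -EFinM exprS.
Qed.

Lemma open_cube_subset n (A : set 'rV[R]_n) x : open A -> A x ->
  exists2 r : R, 0 < r & cube x r `<=` A.
Proof.
move=> oA Ax; have /nbhs_ballP[r /= r0 rA] : nbhs x A by exact: open_nbhs_nbhs.
by exists r => // y xy; apply: rA; split=> // i j; rewrite (ord1 i); exact: xy.
Qed.

(** An open set is the union of the cubes with rational centre and radius
    1 / (k + 1) that it contains, of which there are countably many. *)
Lemma measurable_open n (A : set 'rV[R]_n) : open A -> measurable A.
Proof.
move=> oA.
pose C (p : 'rV[rat]_n * nat) := cube (map_mx (@ratr R) p.1) p.2.+1%:R^-1.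
pose F p := if `[< C p `<=` A >] then C p else set0.
have -> : A = \bigcup_p F p.
  apply/seteqP; split=> [x Ax|x [p _]]; last first.
    by rewrite /F; case: ifPn => // /asboolP; exact.
  have [r r0 rA] := open_cube_subset oA Ax.
  (* A rational point within e of x has x in its e-cube, which lies in the
     2e-cube around x. *)
  have [k kr] : exists k : nat, 2 * k.+1%:R^-1 < r.
    have r20 : 0 < r / 2 by rewrite divr_gt0.
    have [k] := ltr_add_invr r20.
    by rewrite add0r ltr_pdivlMr // mulrC; exists k.
  set e : R := k.+1%:R^-1 in kr.
  have e0 : 0 < e by rewrite invr_gt0.
  have qE i : exists q : rat, ratr q \in `]x ord0 i - e, x ord0 i + e[.
    by apply: rat_in_itvoo; lra.
  have [q qx] := choice qE.
  have close i : `|ratr (q i) - x ord0 i| < e.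
    by have := qx i; rewrite in_itv /= ltr_norml => /andP[? ?]; apply/andP; lra.
  exists (\row_i q i, k) => //; rewrite /F; case: ifPn => [_ i|/asboolP[]].
    by rewrite /ball /= !mxE; exact: close.
  move=> y; rewrite /C /= -/e => Hy; apply: rA => i.
  have := Hy i; have := close i; rewrite /ball /= !mxE !ltr_norml.
  by move=> /andP[? ?] /andP[? ?]; apply/andP; lra.
apply: countable_bigcupT_measurable => [|p].
  exact: countableP.
by rewrite /F; case: ifP => _ //; exact: measurable_cube.
Qed.

Lemma lebesgue_open_gt0 n (A : set 'rV[R]_n) : open A -> A !=set0 ->
  (0 < lebesgue_rV n A)%E.
Proof.
move=> oA [x Ax]; have [r r0 rA] := open_cube_subset oA Ax.
apply: (@lt_le_trans _ _ (lebesgue_rV n (cube x r))).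
  by rewrite lebesgue_cube ?ltW // lte_fin exprn_gt0 // pmulrn_lgt0.
apply: le_measure => //; rewrite inE; first exact: measurable_cube.
exact: measurable_open.
Qed.

Lemma lebesgue_bounded_lty n (A : set 'rV[R]_n) :
  measurable A -> bounded_set A ->
  (lebesgue_rV n A < +oo)%E.
Proof.
move=> mA [M [_ bA]].
have {}bA x : A x -> `|x| <= `|M| + 1.
  by move=> Ax; apply: (bA (`|M| + 1)) => //; have := ler_norm M; lra.
have r0 : 0 <= `|M| + 2 by have := normr_ge0 M; lra.
apply: (@le_lt_trans _ _ (lebesgue_rV n (cube 0 (`|M| + 2)))).
  apply: le_measure; rewrite ?inE //; first exact: measurable_cube.
  move=> x /bA xM i.
  (* the balls of the maximum norm are cubes *)
  have [_ /(_ ord0 i)//] : ball (0 : 'rV[R]_n) (`|M| + 2) x.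
  by rewrite mx_norm_ball /ball_ /= sub0r normrN; lra.
by rewrite lebesgue_cube // ltry.
Qed.

End cubes.

(** * Test pairs with vanishing first component *)

Section zero_function.
Context {R : realType} {d : nat} (Omega GammaD : set 'rV[R]_d).

Lemma partial0 (j : 'I_d) : partial j (fun=> 0 : R) = (fun=> 0).
Proof. by apply/funext => x; rewrite /partial derive_cst. Qed.

Lemma smooth0 : smooth (fun _ : 'rV[R]_d => 0 : R).
Proof.
move=> s /=; have -> : foldr partial (fun _ : 'rV[R]_d => 0 : R) s = (fun=> 0).
  by elim: s => //= j s ->; exact: partial0.
by split=> [|x j]; [exact: cst_continuous|exact: derivable_cst].
Qed.

Lemma weak_gradient0 : weak_gradient Omega (fun=> 0) (fun=> 0).
Proof.
move=> i j phi _; rewrite /Rintegral !integral0_eq ?oppr0 // => x _;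
  by rewrite mxE mul0r.
Qed.

Definition H1_0 : H1 Omega :=
  MkH1 (L2fun0 _ _ _ _) (L2fun0 _ _ _ _) weak_gradient0.

Lemma L2cvg0 dT (T : measurableType dT) (mu : {measure set T -> \bar R})
    (D : set T) m n (f_ : nat -> T -> 'M[R]_(m, n)) f :
  (forall k x, f_ k x = f x) -> L2cvg mu D f_ f.
Proof.
move=> ff; rewrite /L2cvg (_ : (fun k => _) = fun=> 0%E); first exact: cvg_cst.
apply/funext => k; rewrite integral0_eq // => x _.
by rewrite ff subrr frob0l.
Qed.

(** The zero sequence of smooth functions shows that the trace of 0 is 0. *)
Lemma V_0 : V GammaD H1_0.
Proof.
exists (fun=> 0); last exact: aeW.
split; first exact: L2fun0.
exists (fun _ _ => 0); split.
- by move=> k i; rewrite mxE; exact: smooth0.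
- exact: L2cvg0.
- apply: L2cvg0 => k x; apply/matrixP => i j.
  by rewrite !mxE partial0.
- exact: L2cvg0.
Qed.

Lemma Qpoly_cst r (c : R) : Qpoly r (fun _ : 'rV[R]_d => c).
Proof.
pose a0 : {ffun 'I_d -> 'I_r.+1} := [ffun=> ord0].
exists (fun a => if a == a0 then c else 0) => x.
rewrite (bigD1 a0) //= eqxx big1 ?mulr1 => [|i _]; last by rewrite ffunE.
by rewrite big1 ?addr0 // => a /negPf ->; rewrite mul0r.
Qed.

Lemma piecewise_poly_cst (Th : mesh R d) r m n (A : 'M[R]_(m, n)) :
  @piecewise_poly R d Th r m n (fun=> A).
Proof.
move=> T; exists (fun=> A); last exact: aeW.
by move=> i j; exact: Qpoly_cst.
Qed.

Lemma Vhp_0 (Th : mesh R d) : Vhp GammaD Th H1_0.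
Proof. by split; [exact: V_0|exact: piecewise_poly_cst]. Qed.

Lemma VQnorm_0 q : VQnorm H1_0 q = L2norm (lebesgue_rV d) Omega q.
Proof.
rewrite /VQnorm (@L2norm0 _ _ _ _ _ _ _ H1_0) //.
rewrite (@L2norm0 _ _ _ _ _ _ _ (eps H1_0)).
  by rewrite expr0n /= !add0r sqrtr_sqr ger0_norm ?sqrtr_ge0.
by move=> x; rewrite /eps /= trmx0 addr0 scaler0.
Qed.

Lemma L2norm_le_VQnorm (v : H1 Omega) q :
  L2norm (lebesgue_rV d) Omega q <= VQnorm v q.
Proof.
rewrite /VQnorm -[leLHS]ger0_norm ?sqrtr_ge0 // -sqrtr_sqr.
by rewrite ler_sqrt ?addr_ge0 ?sqr_ge0 // lerDr addr_ge0 ?sqr_ge0.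
Qed.

End zero_function.

(** * Nontrivial elements of the discrete space *)

Lemma exists_Sd0_neq0 (R : realType) n : exists2 A : 'M[R]_n.+2, Sd0 A & A != 0.
Proof.
(* the diagonal matrix with entries 1, -1, 0, ..., 0 *)
pose w : 'rV[R]_n.+2 :=
  \row_i (if i == ord0 then 1 else if i == lift ord0 ord0 then -1 else 0).
exists (diag_mx w).
  split; first exact: tr_diag_mx.
  rewrite mxtrace_diag !big_ord_recl !mxE /=.
  rewrite big1 => [|i _]; last by rewrite mxE.
  by rewrite addr0 subrr.
apply/eqP => /matrixP/(_ ord0 ord0); rewrite !mxE !eqxx mulr1n => /eqP.
by rewrite oner_eq0.
Qed.

Lemma exists_Qhp_norm_gt0 (R : realType) n (Omega : set 'rV[R]_n.+2)
    (Th : mesh R n.+2) : measurable Omega ->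
  (0 < lebesgue_rV n.+2 Omega < +oo)%E ->
  exists2 q, Qhp Omega Th q & 0 < L2norm (lebesgue_rV n.+2) Omega q.
Proof.
move=> mO vol; have [A SA A0] := exists_Sd0_neq0 R n.
exists (cst A); last exact: L2norm_cst_gt0.
split; last exact: piecewise_poly_cst.
by split=> //; apply: L2fun_cst => //; case/andP: vol.
Qed.

Theorem mainTheorem20 (R : realType) (d : nat) (hd : d = 2%N \/ d = 3%N)
    (Omega GammaD : set 'rV[R]_d)
    (hOmega : lipschitz_domain Omega)
    (hGammaD : GammaD `<=` boundary Omega)
    (gamma : R) (Th : mesh R d) (hTh : fe_mesh gamma Omega Th)
    (mu : 'rV[R]_d -> 'M[R]_d) (hmu : Qhp Omega Th mu) :
  ereal_sup [set r : \bar R |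
    exists (v : H1 Omega) (q : 'rV[R]_d -> 'M[R]_d),
      [/\ Vhp GammaD Th v, Qhp Omega Th q, VQnorm v q != 0 &
          r = (L2inner (lebesgue_rV d) Omega mu q / VQnorm v q)%:E]] =
  (L2norm (lebesgue_rV d) Omega mu)%:E.
Proof.
have [hne oO _ bO _] := hOmega; have mO := measurable_open oO.
set nu := lebesgue_rV d.
have vol : (0 < nu Omega < +oo)%E.
  by rewrite lebesgue_open_gt0 //= lebesgue_bounded_lty.
have hmu2 : L2fun nu Omega mu by case: hmu => -[].
have N0 (q : 'rV[R]_d -> 'M[R]_d) : 0 <= L2norm nu Omega q by exact: sqrtr_ge0.
apply/eqP; rewrite eq_le; apply/andP; split.
  apply: ge_ereal_sup => _ [v [q [_ [[hq _] _] vq0 ->]]]; rewrite lee_fin.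
  have vq_gt0 : 0 < VQnorm v q by rewrite lt_neqAle eq_sym vq0 sqrtr_ge0.
  rewrite ler_pdivrMr //; apply: (le_trans (ler_norm _)).
  apply: (le_trans (L2inner_abs_le mO hmu2 hq)).
  by rewrite ler_wpM2l // L2norm_le_VQnorm.
(* either mu is its own maximizer or all quotients vanish *)
have [mu0|mu0] := eqVneq (L2norm nu Omega mu) 0; last first.
  apply: ereal_sup_ubound; exists (H1_0 Omega), mu; split=> //.
  - exact: Vhp_0.
  - by rewrite VQnorm_0.
  - rewrite VQnorm_0 -/nu; congr EFin.
    rewrite -[X in X / _]sqr_sqrtr ?L2inner_ge0 //.
    by rewrite -/(L2norm nu Omega mu) expr2 mulfK.
have [q hq q0] : exists2 q, Qhp Omega Th q & 0 < L2norm nu Omega q.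
  by case: hd => hd'; subst d; exact: exists_Qhp_norm_gt0.
have hq2 : L2fun nu Omega q by case: hq => -[].
have muq0 : L2inner nu Omega mu q = 0.
  apply/eqP; rewrite -normr_le0.
  by have := L2inner_abs_le mO hmu2 hq2; rewrite -/nu mu0 mul0r.
rewrite mu0; apply: ereal_sup_ubound; exists (H1_0 Omega), q; split=> //.
- exact: Vhp_0.
- by rewrite VQnorm_0 gt_eqF.
- by rewrite -/nu muq0 mul0r.
Qed.
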